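(* Let $X$ be a Banach space. Then $\widetilde{H}(X)=A_2(X)$, where $$\widetilde{H}(X)=\sup\left\{\frac{\|x\|+\|y\|}{\|x+y\|}: x,y\in X,\ (x,y)\neq(0,0),\ x\perp_I y\right\}$$ and $$A_2(X)=\sup\left\{\frac{\|x+y\|+\|x-y\|}{2}: x,y\in S_X\right\}.$$
   Context: $S_X=\{x\in X:\|x\|=1\}$ is the unit sphere of $X$. Isosceles orthogonality: $x\perp_I y$ means $\|x+y\|=\|x-y\|$. *)

(* Defs.v *)
From HB Require Import structures.
From mathcomp Require Import all_boot all_order all_algebra.
From mathcomp Require Import all_classical all_reals all_analysis.
Set Implicit Arguments.
Unset Strict Implicit.
Unset Printing Implicit Defensive.
Import Order.TTheory GRing.Theory Num.Theory.
Import numFieldNormedType.Exports.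
Local Open Scope classical_set_scope.
Local Open Scope ring_scope.

Definition unit_sphere (R : realType) (X : normedModType R) : set X :=
  [set x | `|x| = 1].
Arguments unit_sphere {R} X _ : rename.

Definition isosceles_orthogonal (R : realType) (X : normedModType R)
    (x y : X) : Prop :=
  `|x + y| = `|x - y|.

(* The suprema are taken in the extended reals, so that they are genuine least
   upper bounds without any boundedness or nonemptiness side condition.  Both
   index sets are empty when X = {0}, and the suprema are then -oo. *)

(* In [Htilde], x + y = 0 would force x - y = 0, hence (x, y) = (0, 0): the
   quotient never involves a division by zero. *)
Definition Htilde (R : realType) (X : normedModType R) : \bar R :=
  ereal_sup [set r : \bar R | exists x y : X,
    [/\ (x, y) <> (0, 0), isosceles_orthogonal x y &
        r = ((`|x| + `|y|) / `|x + y|)%:E]].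

Definition A2 (R : realType) (X : normedModType R) : \bar R :=
  ereal_sup [set r : \bar R | exists x y : X,
    [/\ unit_sphere X x, unit_sphere X y &
        r = ((`|x + y| + `|x - y|) / 2)%:E]].

(* Main.v *)
(** The linear change of variables [u = x + y], [v = x - y] turns isosceles
    orthogonality into [`|u| = `|v|]; since the quotient in [Htilde] is
    homogeneous of degree 0, one may rescale so that [u] and [v] lie on the unit
    sphere.  Hence the two suprema range over the same set. *)
Require Import Defs.
From HB Require Import structures.
From mathcomp Require Import all_boot all_order all_algebra.
From mathcomp Require Import all_classical all_reals all_analysis.
From mathcomp Require Import lra.
Set Implicit Arguments.
Unset Strict Implicit.
Unset Printing Implicit Defensive.
Import Order.TTheory GRing.Theory Num.Theory.
Import numFieldNormedType.Exports.
Local Open Scope classical_set_scope.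
Local Open Scope ring_scope.

Lemma half_add_sub (R : realType) (X : lmodType R) (x y : X) :
  2^-1 *: (x + y) + 2^-1 *: (x - y) = x.
Proof.
rewrite -scalerDr addrACA subrr addr0 scalerDr -scalerDl.
by rewrite -[2^-1]mul1r -splitr scale1r.
Qed.

Lemma half_sub_sub (R : realType) (X : lmodType R) (x y : X) :
  2^-1 *: (x + y) - 2^-1 *: (x - y) = y.
Proof. by rewrite -scalerN opprB [x + y]addrC half_add_sub. Qed.

Lemma isosceles_orthogonal_norm_gt0 (R : realType) (X : normedModType R)
    (x y : X) :
  (x, y) <> (0, 0) -> isosceles_orthogonal x y -> 0 < `|x + y|.
Proof.
move=> xy0 ixy; rewrite normr_gt0; apply/eqP => s0; apply: xy0.
have d0 : x - y = 0 by apply/normr0_eq0; rewrite -ixy s0 normr0.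
have x0 : x = 0 by rewrite -(half_add_sub x y) s0 d0 !scaler0 addr0.
by move: s0; rewrite x0 add0r => ->.
Qed.

Theorem theorem2p4 (R : realType) (X : completeNormedModType R) :
  Htilde X = A2 X.
Proof.
congr ereal_sup; apply/seteqP; split => r [x [y [hx hy ->]]].
- have n0 := isosceles_orthogonal_norm_gt0 hx hy.
  set n := `|x + y| in n0 *.
  have nV0 : 0 <= n^-1 by rewrite invr_ge0 ltW.
  have dbl (z : X) : `|n^-1 *: (z + z)| = n^-1 * (`|z| * 2).
    by rewrite normrZ ger0_norm// -mulr2n normrMn mulr_natr.
  (* Orthogonality makes [n] the norm of both [x + y] and [x - y], so one scaling puts both on the
     sphere. *)
  exists (n^-1 *: (x + y)), (n^-1 *: (x - y)); split.
  + by rewrite /unit_sphere /= normrZ ger0_norm// mulVf// gt_eqF.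
  + by rewrite /unit_sphere /= normrZ ger0_norm// -hy mulVf// gt_eqF.
  (* The sum and difference of the witnesses are [2x / n] and [2y / n]; the factor 2 cancels the
     halving in [A2]. *)
  + rewrite -scalerDr -scalerBr addrACA subrr addr0 opprD addrACA subrr add0r opprK.
    by rewrite !dbl; congr EFin; lra.
- have half (z : X) : `|2^-1 *: z| = `|z| / 2.
    by rewrite normrZ ger0_norm ?invr_ge0// mulrC.
  rewrite /unit_sphere /= in hx hy.
  (* Inverse change of variables: the witnesses have sum [x] and difference [y], so orthogonality
     reads [|x| = |y|] and the denominator is 1. *)
  exists (2^-1 *: (x + y)), (2^-1 *: (x - y)); split.
  (* If both witnesses vanished, so would their sum [x], a unit vector. *)
  + move=> [a0 b0]; move: hx; rewrite -(half_add_sub x y) a0 b0 addr0 normr0.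
    by move=> /esym/eqP; rewrite oner_eq0.
  + by rewrite /isosceles_orthogonal half_add_sub half_sub_sub hx hy.
  + by rewrite half_add_sub hx divr1 !half mulrDl.
Qed.
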